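(* Let $\Xi\subset\mathbb R^m$ and let $f:\mathcal X\times\mathbb R^m\to\mathbb R$ be such that $\xi\mapsto f(x,\xi)$ is bounded on $\Xi$ for every $x\in\mathcal X$. Let $\alpha\ge0$ be a risk level and let $\mathcal P=\{P:\operatorname{MMD}(P,\hat P_N)\le\varepsilon\}$ be the MMD ambiguity set of radius $\varepsilon$ centered at the empirical distribution $\hat P_N$ of the sample $\xi_1,\dots,\xi_N\in\Xi$. Then, for $x\in\mathcal X$, the distributionally robust CVaR constraint $$\sup_{P\in\mathcal P}\operatorname{CVaR}^{P}_{1-\alpha}[f(x,\xi)]\le 0$$ is equivalent to $x\in Z_{\operatorname{CVaR}}$, where $Z_{\operatorname{CVaR}}$ is the set of all $x\in\mathcal X$ for which there exist $g\in\mathcal H$, $g_0\in\mathbb R$ and $t\in\mathbb R$ such that $$g_0+\frac1N\sum_{i=1}^N g(\xi_i)+\varepsilon\|g\|_{\mathcal H}\le t\alpha$$ and $$[f(x,\xi)+t]_+\le g_0+g(\xi)\qquad\text{for all }\xi\in\Xi .$$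
   Context: $\mathcal X\subset\mathbb R^n$. $k:\Xi\times\Xi\to\mathbb R$ is a symmetric positive definite kernel with associated reproducing kernel Hilbert space $\mathcal H$ of functions on $\Xi$ and norm $\|\cdot\|_{\mathcal H}$. For a probability distribution $P$ on $\Xi$, its kernel mean embedding is $\mu_P=\int k(\xi,\cdot)\,dP(\xi)\in\mathcal H$, and $\operatorname{MMD}(P,Q)=\|\mu_P-\mu_Q\|_{\mathcal H}$. The empirical distribution is $\hat P_N=\frac1N\sum_{i=1}^N\delta_{\xi_i}$. The ambiguity set $\mathcal P$ consists of probability distributions on $\Xi$ within MMD distance $\varepsilon>0$ of $\hat P_N$. $[\cdot]_+=\max[0,\cdot]$. The conditional value-at-risk is, in the paper's convention, $\operatorname{CVaR}^{P}_{1-\alpha}[f(x,\xi)]=\inf_{t\in\mathbb R}\mathbb E_P\big[[f(x,\xi)+t]_+-t\alpha\big]$. *)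

(* Defs.v *)
From HB Require Import structures.
From mathcomp Require Import all_boot all_order all_algebra.
From mathcomp Require Import all_classical all_reals all_analysis.

Set Implicit Arguments.
Unset Strict Implicit.
Unset Printing Implicit Defensive.

Import Order.TTheory GRing.Theory Num.Theory.
Import numFieldNormedType.Exports.

Local Open Scope classical_set_scope.
Local Open Scope ring_scope.

(* The library's measurable types are pointed, hence the proof of
   non-emptiness carried by the type; the point it selects is irrelevant. *)
Definition pointed_set (T : Type) (A : set T) (A0 : A !=set0) : Type :=
  set_type A.

Section pointed_set.
Context (T : Type) (A : set T) (A0 : A !=set0).

HB.instance Definition _ := gen_eqMixin (pointed_set A0).
HB.instance Definition _ := gen_choiceMixin (pointed_set A0).
HB.instance Definition _ := isPointed.Build (pointed_set A0)
  (exist (fun x => x \in A) (projT1 (cid A0)) (mem_set (projT2 (cid A0)))).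

End pointed_set.

(* [open] is taken in the subspace topology of [set_type Xi], so that this is
   the trace on Xi of the Borel sigma-algebra of R^m; Xi itself need not be
   Borel. *)
Definition borel_subspace (R : realType) (m : nat) (Xi : set 'rV[R]_m)
    (Xi0 : Xi !=set0) : measurableType _ :=
  g_sigma_algebraType
    ((@open (set_type Xi)) : set (set (pointed_set Xi0))).

Definition subspace_val (R : realType) (m : nat) (Xi : set 'rV[R]_m)
    (Xi0 : Xi !=set0) (xi : borel_subspace Xi0) : 'rV[R]_m :=
  set_val (xi : set_type Xi).

(* "Positive definite" in the sense of reproducing kernels: the Gram matrices
   are positive semidefinite. *)
Definition sym_posdef_kernel (R : realType) (X : Type) (k : X -> X -> R) :=
  (forall x y, k x y = k y x) /\
  (forall (n : nat) (x : 'I_n -> X) (a : 'I_n -> R),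
    0 <= \sum_(i < n) \sum_(j < n) a i * a j * k (x i) (x j)).

(* A Hilbert space of functions on X: the elements of the complete space are
   identified with functions through the injective linear map [rkhs_fun].  By
   the Moore-Aronszajn theorem, [rkhs k] is inhabited for each symmetric
   positive definite k, and its inhabitants are isometric through a map that
   preserves [rkhs_fun]. *)
Record rkhs (R : realType) (X : Type) (k : X -> X -> R) := Rkhs {
  rkhs_space :> completeNormedModType R ;
  rkhs_dot : {dot rkhs_space for idfun} ;
  rkhs_norm : forall g : rkhs_space, `|g| ^+ 2 = rkhs_dot g g ;
  rkhs_fun : rkhs_space -> X -> R ;
  rkhs_fun_linear : forall (a : R) (g h : rkhs_space) (x : X),
    rkhs_fun (a *: g + h) x = a * rkhs_fun g x + rkhs_fun h x ;
  rkhs_fun_inj : injective rkhs_fun ;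
  rkhs_section : X -> rkhs_space ;
  rkhs_sectionE : forall x : X, rkhs_fun (rkhs_section x) = k x ;
  rkhs_reproducing : forall (g : rkhs_space) (x : X),
    rkhs_fun g x = rkhs_dot g (rkhs_section x) }.

Section kernel_mean_embedding.
Context (d : measure_display) (T : measurableType d) (R : realType).
Context (k : T -> T -> R) (H : rkhs k).

(* The vector-valued integral of F : T -> H in the sense of Pettis. *)
Definition is_pettis_integral (P : {measure set T -> \bar R}) (F : T -> H)
    (v : H) :=
  forall h : H,
    P.-integrable setT (fun xi => (rkhs_dot H h (F xi))%:E) /\
    rkhs_dot H h v = \int[P]_xi rkhs_dot H h (F xi).

Definition is_mean_embedding (P : {measure set T -> \bar R}) (mu : H) :=
  is_pettis_integral P (@rkhs_section _ _ _ H) mu.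

(* Meaningful only when a mean embedding exists; it is then unique, because
   the inner product is definite. *)
Definition mean_embedding (P : {measure set T -> \bar R}) : H :=
  xget 0 [set mu | is_mean_embedding P mu].

Definition mmd (P Q : {measure set T -> \bar R}) : R :=
  `|mean_embedding P - mean_embedding Q|.

(* mmd P Q makes sense only for P that have a mean embedding in H; if k is
   bounded and measurable, these are all the probabilities. *)
Definition mmd_ambiguity_set (Q : {measure set T -> \bar R}) (eps : R) :
    set (probability T R) :=
  [set P | (exists mu, is_mean_embedding P mu) /\ mmd P Q <= eps].

End kernel_mean_embedding.

Section empirical.
Context (d : measure_display) (T : measurableType d) (R : realType).
Context (N : nat) (xi : 'I_N -> T).

Definition empirical (A : set T) : \bar R :=
  ((N%:R^-1)%:E * \sum_(i < N) \d_(xi i) A)%E.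

Let dirac_seq : {measure set T -> \bar R}^nat :=
  fun i => if insub i is Some j then dirac (xi j) else mzero.

Let empiricalE :
  empirical = mscale (N%:R^-1)%:nng (msum dirac_seq N).
Proof.
apply/funext => A; rewrite /empirical /mscale /msum /=; congr (_ * _)%E.
by apply: eq_bigr => i _; rewrite /dirac_seq valK.
Qed.

Let empirical0 : empirical set0 = 0%E.
Proof. by rewrite empiricalE measure0. Qed.

Let empirical_ge0 A : (0 <= empirical A)%E.
Proof. by rewrite empiricalE. Qed.

Let empirical_sigma_additive : semi_sigma_additive empirical.
Proof. by rewrite empiricalE; exact: measure_semi_sigma_additive. Qed.

HB.instance Definition _ := isMeasure.Build _ _ _ empirical
  empirical0 empirical_ge0 empirical_sigma_additive.

Lemma empirical_setT : (0 < N)%N -> empirical setT = 1%E.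
Proof.
move=> N0; rewrite /empirical (eq_bigr (fun=> 1%E)) => [|i _]; last first.
  by rewrite diracT.
rewrite sumEFin -EFinM sumr_const card_ord mulVf//.
by rewrite pnatr_eq0 -lt0n.
Qed.

End empirical.
Arguments empirical {d T} R {N} xi.

(* CVaR at level 1 - alpha, with the sign convention for t in which the
   optimal -t is the value-at-risk and without the usual factor 1/alpha. *)
Definition cvar (d : measure_display) (T : measurableType d) (R : realType)
    (P : probability T R) (alpha : R) (X : T -> R) : \bar R :=
  ereal_inf (range (fun t : R =>
    ('E_P[fun xi => (Num.max 0 (X xi + t) - t * alpha)%R])%E)).

Definition Z_cvar (R : realType) (n m : nat) (X : set 'rV[R]_n)
    (Xi : set 'rV[R]_m) (Xi0 : Xi !=set0)
    (k : borel_subspace Xi0 -> borel_subspace Xi0 -> R) (H : rkhs k)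
    (f : 'rV[R]_n -> 'rV[R]_m -> R) (alpha eps : R)
    (N : nat) (xi : 'I_N -> borel_subspace Xi0) : set 'rV[R]_n :=
  [set x | X x /\ exists (g : H) (g0 t : R),
    g0 + N%:R^-1 * (\sum_(i < N) rkhs_fun g (xi i)) + eps * `|g| <= t * alpha /\
    forall z : borel_subspace Xi0,
      Num.max 0 (f x (subspace_val z) + t) <= g0 + rkhs_fun g z].

(* Main.v *)
Require Import Defs.
From HB Require Import structures.
From mathcomp Require Import all_boot all_order all_algebra.
From mathcomp Require Import all_classical all_reals all_analysis.
From mathcomp Require Import measurable_realfun.
From mathcomp Require Import ring lra.

Set Implicit Arguments.
Unset Strict Implicit.
Unset Printing Implicit Defensive.

Import Order.TTheory GRing.Theory Num.Theory.
Import numFieldNormedType.Exports.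

Local Open Scope classical_set_scope.
Local Open Scope ring_scope.

(** If [x] lies in [Z_cvar], its certificate [g0 + g] dominates the integrand of
    the CVaR, and integrating it against [P] gives [g0 + <g, mu_P>], which
    Cauchy-Schwarz and the radius of the ambiguity set bound by
    [g0 + <g, mu_N> + eps * |g|], where [mu_N] is the empirical embedding.

    The converse is a conic duality with an attained dual. Bound the loss [F] by
    [M]. The CVaR is itself a supremum: with [0 <= w <= 1] and [E_P w <= alpha],
    every [E_P (w * (F + M)) - alpha * M] is below it when [alpha <= 1]. So the
    robust constraint says that a linear program over pairs (P, w) has a
    nonpositive value, and it is enough to exploit it for finitely supported P
    and for w with values in {0, 1} on weighted atoms. Nonnegative combinations
    of atoms trace a convex cone K in [H * R * R], whose coordinates measure the
    shift of the embedding (up to [eps] times the mass), the excess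
    [E w - alpha], and the slack in the objective. The constraint says that K
    contains no (0, 0, r) with [r < 0] ([K_ge0]). Since the empirical
    distribution is the centre of a ball of positive radius and [alpha > 0], a
    Slater condition holds ([K_slater]): opposing any perturbation of the first
    two coordinates has a cost proportional to its size. Hence (0, 0, -1) is not
    even in the closure of K ([K_away]). Its projection on that closure
    ([cone_projection], by completeness and the parallelogram law) then yields a
    normal vector whose last coordinate is positive; rescaled, its first two
    coordinates are [g] and the shift of [t] from [M], and its nonnegativity on
    single atoms is the semi-infinite constraint of [Z_cvar]. Since
    (0, 0, -1) is away from K, while (0, 0, 0) may be on its boundary,
    separating the former gives attainment without any passage to the limit.

    For finitely supported P to have an embedding, all the elements of [H] must
    be measurable. Those that are form a closed subspace which contains the
    sections of the kernel, and an element orthogonal to it vanishes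
    ([rkhs_fun_measurable]).

    The extreme levels have explicit certificates with [g = 0]: [t = - M] for
    [alpha = 0], and [t = M / (alpha - 1)] for [alpha > 1]. *)

(** * Projection in a Hilbert space *)

(** A Hilbert space presented by its inner product alone, with completeness for
    the induced distance stated on sequences. In this form the property passes
    to products, for the sum of the inner products, while the maximum of two
    Hilbert norms is not a Hilbert norm. *)
Record is_hilbert (R : realType) (V : lmodType R) (B : V -> V -> R) := {
  hilbertC : forall u v, B u v = B v u ;
  hilbertPl : forall a u v w, B (a *: u + v) w = a * B u w + B v w ;
  hilbert_ge0 : forall u, 0 <= B u u ;
  hilbert_complete : forall u : nat -> V,
    (forall e, 0 < e -> exists n0, forall i j, (n0 <= i)%N -> (n0 <= j)%N ->
      B (u i - u j) (u i - u j) <= e) ->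
    exists p, forall e, 0 < e -> exists n0, forall i, (n0 <= i)%N ->
      B (p - u i) (p - u i) <= e }.

Lemma ler_of_affine_slack (R : realFieldType) (a b : R) : 0 <= b ->
  (forall eta, 0 < eta -> a <= (1 + eta) * b + eta) -> a <= b.
Proof.
move=> b0 h; apply/ler_addgt0Pr => e e0.
have := h (e / (b + 1)) (divr_gt0 e0 (ltr_wpDl b0 ltr01)).
have -> : (1 + e / (b + 1)) * b + e / (b + 1) = b + e by field; lra.
by [].
Qed.

Section projection.
Context (R : realType) (V : lmodType R) (B : V -> V -> R).
Hypothesis BH : is_hilbert B.

Lemma hilbertDl u v w : B (u + v) w = B u w + B v w.
Proof. by rewrite -{1}[u]scale1r hilbertPl// mul1r. Qed.

Lemma hilbert0l w : B 0 w = 0.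
Proof. by apply: (addrI (B 0 w)); rewrite -hilbertDl !addr0. Qed.

Lemma hilbertZl a u w : B (a *: u) w = a * B u w.
Proof. by rewrite -[a *: u]addr0 hilbertPl// hilbert0l addr0. Qed.

Lemma hilbertNl u w : B (- u) w = - B u w.
Proof. by rewrite -scaleN1r hilbertZl mulN1r. Qed.

Lemma hilbertDr u v w : B u (v + w) = B u v + B u w.
Proof. by rewrite !(hilbertC BH u) hilbertDl. Qed.

Lemma hilbertZr a u w : B u (a *: w) = a * B u w.
Proof. by rewrite !(hilbertC BH u) hilbertZl. Qed.

Lemma hilbertNr u w : B u (- w) = - B u w.
Proof. by rewrite !(hilbertC BH u) hilbertNl. Qed.

Definition hilbertE :=
  (hilbertDl, hilbertDr, hilbertNl, hilbertNr, hilbertZl, hilbertZr).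

(** Stands in for the triangle inequality of the norm, in a form that involves
    squared norms only. *)
Lemma hilbert_young eta u v : 0 < eta ->
  B u u <= (1 + eta) * B v v + (1 + eta^-1) * B (u - v) (u - v).
Proof.
move=> eta0; have := hilbert_ge0 BH (eta *: v - (u - v)).
have -> : B u u = B (v + (u - v)) (v + (u - v)) by rewrite subrKC.
move: (u - v) => w; rewrite !hilbertE (hilbertC BH w v).
have := hilbert_ge0 BH v; have := hilbert_ge0 BH w.
set a := B w w; set b := B v v; set c := B v w => a0 b0 h.
have ei : 0 < eta^-1 by rewrite invr_gt0.
have : 0 <= eta^-1 * (eta * (eta * b) + - (eta * c) + (- (eta * c) - - a)).
  by rewrite mulr_ge0 ?(ltW ei)//; lra.
have -> : eta^-1 * (eta * (eta * b) + - (eta * c) + (- (eta * c) - - a)) =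
  eta * b - 2 * c + eta^-1 * a by field; lra.
lra.
Qed.

(** [p] is in the closure of [S] for the distance induced by [B]. *)
Definition near_set (S : set V) (p : V) :=
  forall e, 0 < e -> exists2 s, S s & B (p - s) (p - s) <= e.

(** The obtuse angle characterization of the projection on the closure of a
    convex set: [p] is the limit of a minimizing sequence, and moving from [p]
    towards [s] cannot decrease the distance to [x]. *)
Lemma convex_projection (S : set V) (x : V) : S !=set0 ->
  (forall t u v, 0 < t -> t < 1 -> S u -> S v -> S ((1 - t) *: u + t *: v)) ->
  exists p, near_set S p /\ forall s, S s -> B (x - p) (s - p) <= 0.
Proof.
move=> S0 Scvx; pose D := [set B (x - s) (x - s) | s in S].
have D0 : D !=set0 by case: S0 => s Ss; exists (B (x - s) (x - s)), s.
have Dlb : has_lbound D by exists 0 => _ [s _ <-]; exact: hilbert_ge0.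
have Dinf : has_inf D by [].
pose d := inf D.
have d_le s : S s -> d <= B (x - s) (x - s).
  by move=> Ss; apply: ge_inf => //; exists s.
have d0 : 0 <= d by apply: lb_le_inf => // _ [s _ <-]; exact: hilbert_ge0.
have seq_ex (i : nat) : {s | S s /\ B (x - s) (x - s) < d + i.+1%:R^-1}.
  apply: cid; have [|_ [s Ss <-]] := @inf_adherent _ D i.+1%:R^-1 _ Dinf.
    by rewrite invr_gt0.
  by exists s.
pose u i := projT1 (seq_ex i).
have uS i : S (u i) by rewrite /u; case: (seq_ex i) => ? [].
have ud i : B (x - u i) (x - u i) < d + i.+1%:R^-1.
  by rewrite /u; case: (seq_ex i) => ? [].
have small e : 0 < e -> exists n0, forall i, (n0 <= i)%N -> i.+1%:R^-1 < e :> R.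
  move=> e0; have [n0 _ h] := near_infty_natSinv_lt (PosNum e0).
  by exists n0 => i; exact: h.
have [|p up] := hilbert_complete BH (u := u).
  move=> e e0; have [|n0 n0P] := small (e / 4); first by lra.
  exists n0 => i j ni nj.
  have := n0P i ni; have := n0P j nj; have := ud i; have := ud j.
  have hS : S ((1 - 2^-1) *: u i + 2^-1 *: u j).
    by apply: Scvx => //; lra.
  (* Parallelogram law: the midpoint is in S, hence not closer to x than d. *)
  have := d_le _ hS.
  have -> : x - ((1 - 2^-1) *: u i + 2^-1 *: u j) =
            2^-1 *: (x - u i) + 2^-1 *: (x - u j).
    rewrite !scalerBr addrACA -scalerDl opprD.
    have -> : 1 - 2^-1 = 2^-1 :> R by lra.
    rewrite (_ : 2^-1 + 2^-1 = 1 :> R) ?scale1r//; lra.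
  have -> : u i - u j = (x - u j) - (x - u i).
    by apply/esym; rewrite opprB addrC addrA subrK.
  move: (x - u i) (x - u j) => a b; rewrite !hilbertE (hilbertC BH b a).
  by move: (i.+1%:R^-1) (j.+1%:R^-1) => ri rj; lra.
exists p; split.
  by move=> e /up[n0 /(_ _ (leqnn n0)) h]; exists (u n0).
have xpd : B (x - p) (x - p) <= d.
  (* The steps below make both error terms of hilbert_young at most eta / 2. *)
  apply: ler_of_affine_slack => // eta eta0.
  have i0 : 0 < 1 + eta^-1 by rewrite addr_gt0 ?invr_gt0.
  have [n1 n1P] := up _ (divr_gt0 (divr_gt0 eta0 (ltr0Sn R 1)) i0).
  have [n2 n2P] := small _ (divr_gt0 (divr_gt0 eta0 (ltr0Sn R 1))
    (addr_gt0 ltr01 eta0)).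
  pose i := maxn n1 n2.
  have := hilbert_young (x - p) (x - u i) eta0.
  have -> : x - p - (x - u i) = - (p - u i).
    by rewrite !opprB addrC addrA subrK.
  rewrite hilbertNl hilbertNr opprK => /le_trans; apply.
  have /(ler_wpM2l (ltW i0)) := n1P i (leq_maxl _ _).
  rewrite [leRHS]mulrC divfK ?gt_eqF// => h1.
  have : (1 + eta) * B (x - u i) (x - u i) <= (1 + eta) * d + eta / 2.
    have /(ler_wpM2l (ltW (addr_gt0 ltr01 eta0))) := ltW (n2P i (leq_maxr _ _)).
    rewrite [leRHS]mulrC divfK ?gt_eqF ?addr_gt0// => h2.
    have /ltW/(ler_wpM2l (ltW (addr_gt0 ltr01 eta0))) := ud i.
    by move: (i.+1%:R^-1) h2 => ri h2; lra.
  lra.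
have dS t s : 0 < t -> t < 1 -> S s ->
    d <= B (x - ((1 - t) *: p + t *: s)) (x - ((1 - t) *: p + t *: s)).
  move=> t0 t1 Ss; set q := (1 - t) *: p + t *: s.
  apply: ler_of_affine_slack => [|eta eta0]; first exact: hilbert_ge0.
  have i0 : 0 < 1 + eta^-1 by rewrite addr_gt0 ?invr_gt0.
  have [n1 /(_ _ (leqnn n1)) n1P] := up _ (divr_gt0 eta0 i0).
  have Sn : S ((1 - t) *: u n1 + t *: s) by exact: Scvx.
  apply: le_trans (d_le _ Sn) _.
  apply: le_trans (hilbert_young _ (x - q) eta0) _.
  rewrite lerD2l.
  have -> : x - ((1 - t) *: u n1 + t *: s) - (x - q) = (1 - t) *: (p - u n1).
    by rewrite opprB addrC addrA subrK /q opprD addrACA subrr addr0 -scalerBr.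
  rewrite hilbertZl hilbertZr mulrA.
  have /(ler_wpM2l (ltW i0)) := n1P.
  rewrite mulrCA mulfV ?gt_eqF// mulr1; apply: le_trans.
  apply: ler_wpM2l; first exact: ltW.
  by rewrite ler_piMl ?hilbert_ge0//; nra.
move=> s Ss; set y := x - p; set e := s - p.
have key t : 0 < t -> t < 1 -> 2 * B y e <= t * B e e.
  move=> t0 t1; have := le_trans xpd (dS t s t0 t1 Ss).
  have -> : x - ((1 - t) *: p + t *: s) = y - t *: e.
    by rewrite /y /e scalerBl scale1r scalerBr -addrA (addrC (- _)) opprD addrA.
  rewrite -/y; move: (y) (e) => {}y {}e; rewrite !hilbertE (hilbertC BH e y) => h.
  by rewrite -(ler_pM2l t0); lra.
have e0 := hilbert_ge0 BH e.
apply/ler_addgt0Pr => r r0; rewrite add0r.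
have q0 : 0 < B e e + 1 + r by lra.
have t0 : 0 < r / (B e e + 1 + r) by rewrite divr_gt0.
have t1 : r / (B e e + 1 + r) < 1 by rewrite ltr_pdivrMr//; lra.
have := key _ t0 t1.
have : r / (B e e + 1 + r) * B e e <= r.
  by rewrite mulrAC ler_pdivrMr//; nra.
lra.
Qed.

(** For a cone, dilating and contracting [s] in the obtuse angle inequality
    separates the roles of [s] and [p]. *)
Lemma cone_projection (K : set V) (x : V) : K !=set0 ->
  (forall u v, K u -> K v -> K (u + v)) ->
  (forall a u, 0 < a -> K u -> K (a *: u)) ->
  exists p, [/\ near_set K p, forall s, K s -> B (x - p) s <= 0 &
    0 <= B (x - p) p].
Proof.
move=> K0 KD KZ.
have [|p [Kp hp]] := @convex_projection K x K0.
  by move=> t u v t0 t1 Ku Kv; apply: KD; apply: KZ => //; lra.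
have hZ s a : K s -> 0 < a -> a * B (x - p) s <= B (x - p) p.
  by move=> Ks a0; have := hp _ (KZ _ _ a0 Ks); rewrite !hilbertE; lra.
have p0 : 0 <= B (x - p) p.
  case: K0 => s Ks; apply/ler_addgt0Pr => r r0.
  have q0 : 0 < `|B (x - p) s| + 1 by rewrite ltr_wpDl.
  have := hZ s (r / (`|B (x - p) s| + 1)) Ks (divr_gt0 r0 q0).
  have : - r <= r / (`|B (x - p) s| + 1) * B (x - p) s.
    rewrite mulrAC ler_pdivlMr//.
    have := ler_norm (- B (x - p) s); rewrite normrN; nra.
  lra.
exists p; split=> // s Ks; rewrite leNgt; apply/negP => hs.
have := hZ s ((B (x - p) p + 1) / B (x - p) s) Ks.
by rewrite divfK ?gt_eqF// => /(_ (divr_gt0 (ltr_wpDl p0 ltr01) hs)); lra.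
Qed.

End projection.

(** * Reproducing kernel Hilbert spaces *)

Lemma is_hilbert_normed (R : realType) (V : completeNormedModType R)
    (B : V -> V -> R) :
  (forall u v, B u v = B v u) ->
  (forall a u v w, B (a *: u + v) w = a * B u w + B v w) ->
  (forall u, `|u| ^+ 2 = B u u) -> is_hilbert B.
Proof.
move=> BC Bl Bn; split=> //; first by move=> u; rewrite -Bn sqr_ge0.
move=> u uC; have /cvg_ex[p up] : cvg (u @ \oo).
  apply: cauchy_cvg; apply: cauchy_exP => e e0.
  have [|n0 n0P] := uC ((e / 2) ^+ 2); first by rewrite exprn_gt0 ?divr_gt0.
  exists (u n0); exists n0 => // i /= ni.
  have := n0P n0 i (leqnn _) ni; rewrite -Bn -ball_normE /=.
  by rewrite ler_sqr ?nnegrE ?divr_ge0 ?(ltW e0)// => /le_lt_trans; apply; lra.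
exists p => e e0.
have m0 : 0 < Num.min 1 e by rewrite lt_min ltr01.
have /cvgrPdist_le/(_ _ m0)[n0 _ n0P] := up.
exists n0 => i /n0P /=; rewrite -Bn le_min => /andP[h1 h2].
by apply: le_trans h2; rewrite expr2 ler_piMl.
Qed.

Lemma is_hilbert_prod (R : realType) (V W : lmodType R) (B : V -> V -> R)
    (C : W -> W -> R) : is_hilbert B -> is_hilbert C ->
  is_hilbert (fun u v : V * W => B u.1 v.1 + C u.2 v.2).
Proof.
move=> BH CH; split=> [u v|a u v w|u|u uC].
- by rewrite (hilbertC BH) (hilbertC CH).
- by rewrite /= (hilbertPl BH) (hilbertPl CH) mulrDr addrACA.
- by rewrite addr_ge0 ?(hilbert_ge0 BH) ?(hilbert_ge0 CH).
have [|p pP] := hilbert_complete BH (u := fst \o u).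
  move=> e /uC[n0 n0P]; exists n0 => i j ni nj /=.
  by apply: le_trans (n0P i j ni nj); rewrite lerDl (hilbert_ge0 CH).
have [|q qP] := hilbert_complete CH (u := snd \o u).
  move=> e /uC[n0 n0P]; exists n0 => i j ni nj /=.
  by apply: le_trans (n0P i j ni nj); rewrite lerDr (hilbert_ge0 BH).
exists (p, q) => e e0; have e20 : 0 < e / 2 by lra.
have [n1 n1P] := pP _ e20; have [n2 n2P] := qP _ e20.
exists (maxn n1 n2) => i; rewrite geq_max => /andP[/n1P /= h1 /n2P /= h2].
lra.
Qed.

Section rkhs.
Context (d : measure_display) (T : measurableType d) (R : realType).
Context (k : T -> T -> R) (H : rkhs k).
Let dot := rkhs_dot H.

Lemma dotC u v : dot u v = dot v u.
Proof. by have := hermC dot u v; rewrite /= expr0 mul1r. Qed.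

Lemma is_hilbert_rkhs : is_hilbert dot.
Proof.
apply: is_hilbert_normed => [u v|a u v w|u].
- exact: dotC.
- by rewrite linearPl.
- exact: rkhs_norm.
Qed.

Let HH := is_hilbert_rkhs.

Lemma cauchy_schwarz (u v : H) : dot u v <= `|u| * `|v|.
Proof.
have := hilbert_ge0 HH (`|v| *: u - `|u| *: v).
rewrite !(hilbertE HH) (dotC v u) /dot -!rkhs_norm -/dot => h.
have [->|v0] := eqVneq v 0.
  by rewrite dotC (hilbert0l HH) normr0 mulr0.
have [->|u0] := eqVneq u 0; first by rewrite (hilbert0l HH) normr0 mul0r.
have : 0 < `|u| * `|v| by rewrite mulr_gt0// normr_gt0.
move: h; set a := `|u|; set b := `|v|; set c := dot u v => h ab0.
have : (a * b) * c <= (a * b) * (a * b) by lra.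
by rewrite ler_pM2l.
Qed.

(** The measurable elements form a subspace S, closed because convergence in [H]
    implies pointwise convergence, and containing the sections of [k]. The
    difference between [h] and its projection on S is orthogonal to these
    sections, hence is the zero function. *)
Lemma rkhs_fun_measurable (h : H) :
  (forall z, measurable_fun setT (k z)) -> measurable_fun setT (rkhs_fun h).
Proof.
move=> mk; pose S := [set v : H | measurable_fun setT (rkhs_fun v)].
have S0 : S !=set0 by exists (rkhs_section H point); rewrite /S /= rkhs_sectionE.
have SD u v : S u -> S v -> S (u + v).
  move=> Su Sv; rewrite /S /= (_ : rkhs_fun _ = rkhs_fun u \+ rkhs_fun v).
    exact: measurable_funD.
  by apply/funext => z; rewrite -{1}[u]scale1r rkhs_fun_linear mul1r.
have fun0 z : rkhs_fun (0 : H) z = 0.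
  by have := rkhs_fun_linear (-1) (0 : H) 0 z; rewrite scaler0 addr0; lra.
have SZ a u : S u -> S (a *: u).
  move=> Su; rewrite /S /= (_ : rkhs_fun _ = fun z => a * rkhs_fun u z).
    by apply: measurable_funM => //; exact: measurable_cst.
  by apply/funext => z; rewrite -[a *: u]addr0 rkhs_fun_linear fun0 addr0.
have [|p [Sp hp _]] := cone_projection HH h S0 SD; first by move=> a u _; exact: SZ.
have -> : h = p.
  apply/eqP; rewrite -subr_eq0; apply/eqP/(@rkhs_fun_inj _ _ _ H).
  apply/funext => z; rewrite fun0 rkhs_reproducing -/dot.
  have Sz : S (rkhs_section H z) by rewrite /S /= rkhs_sectionE.
  have := hp _ Sz; have := hp _ (SZ (-1) _ Sz).
  by rewrite (hilbertZr HH) => ? ?; lra.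
have seq_ex (i : nat) : {s | S s /\ dot (p - s) (p - s) <= (i.+1%:R^-1) ^+ 2}.
  apply: cid; have [|s] := Sp (i.+1%:R^-1 ^+ 2); last by exists s.
  by rewrite exprn_gt0// invr_gt0.
apply: (@measurable_fun_cvg _ _ _ _ (fun i => rkhs_fun (projT1 (seq_ex i)))).
  by move=> i; case: (seq_ex i) => s [].
move=> z _; apply/cvgrPdist_le => e e0.
pose c := `|rkhs_section H z| + 1.
have c0 : 0 < c by rewrite ltr_wpDl.
have [n0 _ n0P] := near_infty_natSinv_lt (PosNum (divr_gt0 e0 c0)).
exists n0 => // i /n0P /= {n0P} ni; case: (seq_ex i) => s /= [_].
rewrite /dot -rkhs_norm ler_sqr ?nnegrE ?invr_ge0// => sp.
have fB : rkhs_fun p z - rkhs_fun s z = dot (p - s) (rkhs_section H z).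
  by rewrite !rkhs_reproducing (hilbertDl HH) (hilbertNl HH).
have fB' : - (rkhs_fun p z - rkhs_fun s z) = dot (s - p) (rkhs_section H z).
  by rewrite fB -(hilbertNl HH) opprB.
have le1 : `|p - s| * `|rkhs_section H z| <= e.
  apply: (@le_trans _ _ (e / c * c)); last by rewrite divfK ?gt_eqF.
  apply: ler_pM => //; last by rewrite lerDl.
  exact/ltW/(le_lt_trans sp).
rewrite ler_norml; apply/andP; split; last first.
  by rewrite fB (le_trans (cauchy_schwarz _ _)).
rewrite lerNl fB' (le_trans (cauchy_schwarz _ _))//.
by rewrite distrC.
Qed.

End rkhs.

(** * Finitely supported measures and their embeddings *)

Section atomic.
Context (d : measure_display) (T : measurableType d) (R : realType).
Context (A : Type) (c : A -> {nonneg R}) (z : A -> T).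

Fixpoint atomic (s : seq A) : {measure set T -> \bar R} :=
  if s is a :: s' then measure_add (mscale (c a) (dirac (z a))) (atomic s')
  else mzero.

Lemma atomicE s D :
  atomic s D = (\sum_(a <- s) ((c a)%:num)%:E * \d_(z a) D)%E.
Proof.
elim: s => [|a s IHs]; first by rewrite big_nil.
by rewrite big_cons -IHs [LHS]measure_addE.
Qed.

Lemma ge0_integral_atomic s (h : T -> R) :
  measurable_fun setT h -> (forall x, 0 <= h x) ->
  (\int[atomic s]_x (h x)%:E)%E = (\sum_(a <- s) (c a)%:num * h (z a))%:E.
Proof.
move=> mh h0; have mEh : measurable_fun setT (EFin \o h).
  exact/measurable_EFinP.
elim: s => [|a s IHs] /=; first by rewrite big_nil integral_measure_zero.
rewrite ge0_integral_measure_add//; last by move=> x _; rewrite lee_fin.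
rewrite IHs big_cons EFinD ge0_integral_mscale//; last first.
  by move=> x _; rewrite lee_fin.
by rewrite integral_dirac// diracT mul1e.
Qed.

Lemma integrable_atomic s (h : T -> R) :
  measurable_fun setT h -> (atomic s).-integrable setT (EFin \o h).
Proof.
move=> mh; apply/integrableP; split; first exact/measurable_EFinP.
rewrite (ge0_integral_atomic _ (h := fun x => `|h x|)) ?ltry//.
exact: measurableT_comp.
Qed.

Lemma integral_atomic s (h : T -> R) : measurable_fun setT h ->
  (\int[atomic s]_x (h x)%:E)%E = (\sum_(a <- s) (c a)%:num * h (z a))%:E.
Proof.
move=> mh; rewrite integralE.
have -> : (EFin \o h)^\+%E = EFin \o h^\+ by rewrite -funerpos.
have -> : (EFin \o h)^\-%E = EFin \o h^\- by rewrite -funerneg.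
rewrite !ge0_integral_atomic//.
- rewrite -EFinB -sumrB; congr EFin; apply: eq_bigr => a _.
  by rewrite -mulrBr -[h in RHS]funrposBneg.
- exact: measurable_funrneg.
- exact: measurable_funrpos.
Qed.

(** The normalization of a measure of mass 1 packages it as a probability. *)
Lemma atomic_probability s : \sum_(a <- s) (c a)%:num = 1 ->
  exists P : probability T R, (P : set T -> \bar R) = atomic s.
Proof.
move=> s1.
have s1' : atomic s setT = 1%E.
  rewrite atomicE -[in RHS]s1 -sumEFin.
  by apply: eq_bigr => a _; rewrite diracT mule1.
exists (mnormalize (atomic s) (dirac point)); apply/funext => D /=.
by rewrite /mnormalize s1' onee_eq0/= invr1 mule1.
Qed.

End atomic.

Section mean_embedding.
Context (d : measure_display) (T : measurableType d) (R : realType).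
Context (k : T -> T -> R) (H : rkhs k).
Hypothesis mk : forall z, measurable_fun setT (k z).
Let dot := rkhs_dot H.
Let HH := is_hilbert_rkhs H.

Lemma mean_embeddingE (P : {measure set T -> \bar R}) u :
  is_mean_embedding P u -> mean_embedding H P = u.
Proof.
move=> Pu; rewrite /mean_embedding.
case: xgetP => [v _ Pv|/(_ u)//]; apply/eqP; rewrite -subr_eq0.
rewrite -normr_eq0 -sqrf_eq0 rkhs_norm -/dot (hilbertDr HH) (hilbertNr HH).
by rewrite (Pu _).2 (Pv _).2 subrr.
Qed.

Context (A : Type) (c : A -> {nonneg R}) (z : A -> T).

Lemma dot_sumr u (s : seq A) (F : A -> H) :
  dot u (\sum_(a <- s) (c a)%:num *: F a) =
  \sum_(a <- s) (c a)%:num * dot u (F a).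
Proof.
elim: s => [|a s IHs]; first by rewrite !big_nil (hilbertC HH) (hilbert0l HH).
by rewrite !big_cons (hilbertDr HH) (hilbertZr HH) IHs.
Qed.

Lemma is_mean_embedding_atomic (P : {measure set T -> \bar R}) s :
  P = atomic c z s :> (set T -> \bar R) ->
  is_mean_embedding P (\sum_(a <- s) (c a)%:num *: rkhs_section H (z a)).
Proof.
move=> Ps h.
have mh : measurable_fun setT (fun x => dot h (rkhs_section H x)).
  rewrite (_ : (fun x => _) = rkhs_fun h); first exact: rkhs_fun_measurable.
  by apply/funext => x; rewrite rkhs_reproducing.
split; first by rewrite Ps; exact: integrable_atomic.
by rewrite dot_sumr /Rintegral Ps (integral_atomic c z s mh).
Qed.

End mean_embedding.

Lemma empirical_atomic (d : measure_display) (T : measurableType d)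
    (R : realType) (N : nat) (xi : 'I_N -> T) :
  empirical R xi = atomic (fun=> (N%:R^-1)%:nng) xi (enum 'I_N)
    :> (set T -> \bar R).
Proof.
apply/funext => D; rewrite atomicE /empirical/= big_enum/= ge0_sume_distrr//.
Qed.

(** * Certificates for the robust CVaR constraint *)

Section duality.
Context (d : measure_display) (T : measurableType d) (R : realType).
Context (k : T -> T -> R) (H : rkhs k).
Hypothesis mk : forall z, measurable_fun setT (k z).
Let dot := rkhs_dot H.
Let HH := is_hilbert_rkhs H.
Let phi := rkhs_section H.
Context (N : nat) (xi : 'I_N -> T) (alpha eps : R) (F : T -> R).
Hypothesis eps0 : 0 < eps.
Hypothesis N0 : (0 < N)%N.
Hypothesis mF : measurable_fun setT F.

Definition empirical_mean : H := N%:R^-1 *: \sum_(i < N) phi (xi i).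

Lemma is_mean_embedding_empirical :
  is_mean_embedding (empirical R xi) empirical_mean.
Proof.
have := is_mean_embedding_atomic (H := H) mk (empirical_atomic R xi).
by rewrite big_enum/= -scaler_sumr.
Qed.

Lemma dot_empirical_mean (g : H) :
  dot g empirical_mean = N%:R^-1 * \sum_(i < N) rkhs_fun g (xi i).
Proof.
rewrite (hilbertZr HH); congr (_ * _).
rewrite (big_morph (dot g) (hilbertDr HH g) (id1 := 0)); last first.
  by rewrite (hilbertC HH) (hilbert0l HH).
by apply: eq_bigr => i _; rewrite rkhs_reproducing.
Qed.

Lemma mmd_ambiguity_setP (P : probability T R) (u : H) :
  is_mean_embedding P u ->
  mmd_ambiguity_set H (empirical R xi) eps P <-> `|u - empirical_mean| <= eps.
Proof.
move=> Pu; rewrite /mmd_ambiguity_set /= /mmd (mean_embeddingE Pu).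
rewrite (mean_embeddingE is_mean_embedding_empirical).
by split=> [[]//|h]; split=> //; exists u.
Qed.

Let mloss t : measurable_fun setT (fun z => Num.max 0 (F z + t) - t * alpha).
Proof.
apply: measurable_funB => //; apply: measurable_maxr => //.
exact: measurable_funD.
Qed.

Lemma integrable_add_cst (P : probability T R) (u : T -> R) (a : R) :
  P.-integrable setT (EFin \o u) ->
  P.-integrable setT (EFin \o (fun z => u z + a)).
Proof.
move=> ui; rewrite (_ : EFin \o _ = ((EFin \o u) \+ cst a%:E)%E)//.
by apply: integrableD => //; exact: finite_measure_integrable_cst.
Qed.

(** Weak duality, by integrating the pointwise bound; as the maximum is
    nonnegative, this bound also makes it integrable. *)
Lemma cvar_le0_of_certificate (g : H) (g0 t : R) (P : probability T R) :
  g0 + dot g empirical_mean + eps * `|g| <= t * alpha ->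
  (forall z, Num.max 0 (F z + t) <= g0 + rkhs_fun g z) ->
  mmd_ambiguity_set H (empirical R xi) eps P -> (cvar P alpha F <= 0)%E.
Proof.
move=> hg hF Pamb; have [[u Pu] _] := Pamb.
have {}Pamb := (mmd_ambiguity_setP Pu).1 Pamb.
apply: le_trans; first by apply: ereal_inf_lbound; exists t.
have [gi gu] := Pu g.
have fg : (fun z => dot g (phi z)) = rkhs_fun g.
  by apply/funext => z; rewrite rkhs_reproducing.
have gint : P.-integrable setT (EFin \o (fun z => rkhs_fun g z + (g0 - t * alpha))).
  by apply: integrable_add_cst; rewrite -fg.
have hint : P.-integrable setT (EFin \o (fun z => Num.max 0 (F z + t) - t * alpha)).
  apply: integrable_add_cst.
  apply: (@le_integrable _ _ _ P setT _ _ (EFin \o (fun z => rkhs_fun g z + g0))) => //.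
  - by apply/measurable_EFinP/measurable_maxr => //; exact: measurable_funD.
  - move=> z _; rewrite lee_fin ger0_norm ?le_max ?lexx//.
    by rewrite (le_trans (hF z))// addrC ler_norm.
  - by apply: integrable_add_cst; rewrite -fg.
rewrite unlock.
apply: le_trans.
  apply: (le_integral _ hint gint) => // z _; rewrite lee_fin.
  by have := hF z; lra.
rewrite (_ : (fun _ => _) = (EFin \o rkhs_fun g \+ cst (g0 - t * alpha)%:E)%E)//.
rewrite integralD//; [|by rewrite -fg|exact: finite_measure_integrable_cst].
rewrite integral_cst// [X in (_ * X)%E]probability_setT mule1.
rewrite -fg -[X in (X + _)%E]fineK ?integrable_fin_num//.
rewrite -EFinD lee_fin -/(Rintegral _ _ _) -gu.
have := cauchy_schwarz g (u - empirical_mean).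
rewrite (hilbertDr HH) (hilbertNr HH) -/dot => h1.
have := ler_wpM2l (normr_ge0 g) Pamb; lra.
Qed.

(** The infimum in the CVaR need not be attained, hence the margin [e]. *)
Lemma cvar_atomic_le0 (A : Type) (c : A -> {nonneg R}) (z : A -> T) (s : seq A)
    (P : probability T R) (e : R) :
  P = atomic c z s :> (set T -> \bar R) -> (cvar P alpha F <= 0)%E -> 0 < e ->
  exists t, \sum_(a <- s) (c a)%:num * (Num.max 0 (F (z a) + t) - t * alpha) < e.
Proof.
move=> Ps cv e0.
have : (cvar P alpha F < e%:E)%E by apply: (le_lt_trans cv); rewrite lte_fin.
move=> /ereal_inf_lt[_ [t _ <-]]; rewrite unlock Ps => h; exists t.
by move: h; rewrite (integral_atomic c z s (mloss t)) lte_fin.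
Qed.

Context (M : R).
Hypothesis FM : forall z, `|F z| <= M.
Hypothesis alpha0 : 0 < alpha.
Hypothesis alpha1 : alpha <= 1.
Hypothesis cvar_le0 : forall P : probability T R,
  mmd_ambiguity_set H (empirical R xi) eps P -> (cvar P alpha F <= 0)%E.

(** A weight, a point of the space, and the value of [w] on that atom. *)
Let atom := ({nonneg R} * (T * bool))%type.

Definition tot (V : lmodType R) (G : T * bool -> V) (s : seq atom) : V :=
  \sum_(a <- s) a.1%:num *: G a.2.

Lemma tot_cat (V : lmodType R) (G : T * bool -> V) s1 s2 :
  tot G (s1 ++ s2) = tot G s1 + tot G s2.
Proof. exact: big_cat. Qed.

Definition scale_atoms (l : {nonneg R}) (s : seq atom) : seq atom :=
  [seq ((l%:num * a.1%:num)%:nng, a.2) | a <- s].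

Lemma tot_scale (V : lmodType R) (G : T * bool -> V) l s :
  tot G (scale_atoms l s) = l%:num *: tot G s.
Proof.
rewrite /tot big_map scaler_sumr; apply: eq_bigr => a _ /=.
by rewrite scalerA.
Qed.

Let mass : T * bool -> R^o := fun=> 1.
Let shift (a : T * bool) : H := phi a.1 - empirical_mean.
Let excess (a : T * bool) : R^o := a.2%:R - alpha.
Let slack (a : T * bool) : R^o := alpha * M - a.2%:R * (F a.1 + M).

Let tot_shift s : tot shift s =
  \sum_(a <- s) a.1%:num *: phi a.2.1 - tot mass s *: empirical_mean.
Proof.
rewrite /tot scaler_suml -sumrB; apply: eq_bigr => a _.
by rewrite scalerBr /mass /GRing.scale /= mulr1.
Qed.

Let tot_mass_ge0 s : 0 <= tot mass s.
Proof. by apply: sumr_ge0 => a _; rewrite /mass mulr_ge0. Qed.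

(** Ensures that atoms of total mass 0 have a nonnegative total slack. *)
Lemma slack_lb (y : R) (b : bool) : `|y| <= M ->
  - (2 * M) <= alpha * M - b%:R * (y + M).
Proof.
rewrite ler_norml => /andP[yM My].
have ? : 0 <= alpha * M by rewrite mulr_ge0 ?(ltW alpha0)//; lra.
by case: b => /=; rewrite ?mulr0n ?mulr1n; lra.
Qed.

(** One term of the inequality [E (w * (F + M)) <= alpha * M]. The multiplier of
    [b - alpha] is [M - t] when [t <= M]. For larger [t] the integrand of the
    CVaR is bounded below by its value with [y + t] in place of the maximum,
    which increases with [t] because [alpha <= 1]. *)
Lemma slack_ge (t y : R) (b : bool) : 0 <= y + M ->
  - (Num.max 0 (y + t) - t * alpha) <=
  alpha * M - b%:R * (y + M) + Num.max 0 (M - t) * (b%:R - alpha).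
Proof.
move=> hM.
have h0 : 0 <= Num.max 0 (y + t) by rewrite le_max lexx.
have h1 : y + t <= Num.max 0 (y + t) by rewrite le_max lexx orbT.
have [tM|tM] := leP (M - t) 0.
  have ? : 0 <= (t - M) * (1 - alpha) by rewrite mulr_ge0 ?subr_ge0// -subr_le0.
  by case: b => /=; rewrite ?mulr0n ?mulr1n; lra.
by case: b => /=; rewrite ?mulr0n ?mulr1n; lra.
Qed.

Lemma slack_ge0_of_probability s : tot mass s = 1 -> `|tot shift s| <= eps ->
  tot excess s <= 0 -> 0 <= tot slack s.
Proof.
move=> s1; rewrite tot_shift s1 scale1r => ps es.
have [P Ps] : exists P : probability T R,
    (P : set T -> \bar R) = atomic (fun a : atom => a.1) (fun a => a.2.1) s.
  apply: atomic_probability; rewrite -[RHS]s1.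
  by apply: eq_bigr => a _; rewrite /mass /GRing.scale /= mulr1.
have Pamb := (mmd_ambiguity_setP (is_mean_embedding_atomic (H := H) mk Ps)).2 ps.
apply/ler_addgt0Pr => e e0.
have [t te] := cvar_atomic_le0 Ps (cvar_le0 Pamb) e0.
suff : - \sum_(a <- s) a.1%:num * (Num.max 0 (F a.2.1 + t) - t * alpha)
    <= tot slack s + Num.max 0 (M - t) * tot excess s.
  have : Num.max 0 (M - t) * tot excess s <= 0.
    by rewrite mulr_ge0_le0// le_max lexx.
  lra.
rewrite -sumrN /tot mulr_sumr -big_split/=; apply: ler_sum => a _.
rewrite /slack /excess /GRing.scale /=.
have -> : a.1%:num * (alpha * M - a.2.2%:R * (F a.2.1 + M)) +
    Num.max 0 (M - t) * (a.1%:num * (a.2.2%:R - alpha)) =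
  a.1%:num * (alpha * M - a.2.2%:R * (F a.2.1 + M) +
    Num.max 0 (M - t) * (a.2.2%:R - alpha)) by ring.
rewrite -mulrN ler_wpM2l//.
by apply: slack_ge; have := FM a.2.1; rewrite ler_norml => /andP[]; lra.
Qed.

(** The ball of radius [eps] is absorbed in K, so that separating a point from K
    amounts to separating the weighted atoms from the ambiguity ball. *)
Let K : set (H * R^o * R^o) := [set q | exists s,
  [/\ `|q.1.1 - tot shift s| <= eps * tot mass s,
      tot excess s <= q.1.2 & tot slack s <= q.2]].

Let K_add u v : K u -> K v -> K (u + v).
Proof.
move=> [s [s1 s2 s3]] [s' [s1' s2' s3']]; exists (s ++ s').
rewrite !tot_cat; split; [|exact: lerD|exact: lerD].
rewrite mulrDr opprD addrACA (le_trans (ler_normD _ _))//.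
exact: lerD.
Qed.

Let K_scale (l : R) u : 0 < l -> K u -> K (l *: u).
Proof.
move=> l0 [s [s1 s2 s3]]; exists (scale_atoms (NngNum (ltW l0)) s).
rewrite !tot_scale/=; split; [|by rewrite /GRing.scale/= ler_pM2l..].
by rewrite -scalerBr normrZ gtr0_norm// mulrCA ler_pM2l.
Qed.

(** The primal side of the duality: normalizing the atoms gives a probability of
    the ambiguity set. *)
Let K_ge0 r : K (0, 0, r) -> 0 <= r.
Proof.
move=> [s [/= s1 s2 s3]]; apply: le_trans s3.
have := tot_mass_ge0 s; rewrite le_eqVlt => /predU1P[m0|m0].
  suff : (- (2 * M)) * tot mass s <= tot slack s by rewrite -m0 mulr0.
  rewrite /tot mulr_sumr; apply: ler_sum => a _.
  rewrite /mass /slack /GRing.scale /= mulr1 mulrC ler_wpM2l//.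
  exact: slack_lb.
have m0' : 0 < (tot mass s)^-1 by rewrite invr_gt0.
rewrite -(pmulr_rge0 _ m0').
pose s' := scale_atoms (NngNum (ltW m0')) s.
have := @slack_ge0_of_probability s'; rewrite !tot_scale /=; apply.
- by rewrite /GRing.scale/= mulVf// gt_eqF.
- rewrite sub0r normrN in s1.
  by rewrite normrZ gtr0_norm// mulrC ler_pdivrMr.
- by rewrite /GRing.scale/= pmulr_rle0.
Qed.

(** The cost in [K_slater] is at most this constant times the larger of the two
    perturbations. *)
Let value_lipschitz := alpha * M * (eps^-1 + alpha^-1).

(** Slater's condition: the empirical atoms, all with [w = 0], have no shift and
    a negative excess, so a mass [m] of them absorbs a shift of norm [eps * m]
    and an excess of [- alpha * m]. *)
Let K_slater v b : K (v, b, alpha * M * (eps^-1 * `|v| + alpha^-1 * `|b|)).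
Proof.
pose m := eps^-1 * `|v| + alpha^-1 * `|b|.
have m0 : 0 <= m by rewrite addr_ge0// mulr_ge0// invr_ge0 ltW.
have iN0 : 0 <= N%:R^-1 :> R by rewrite invr_ge0.
pose s0 : seq atom := [seq (NngNum iN0, (xi i, false)) | i <- enum 'I_N].
have N0' : (N%:R : R) != 0 by rewrite pnatr_eq0 -lt0n.
have t1 : tot mass s0 = 1.
  rewrite /tot big_map big_enum/= /mass sumr_const card_ord.
  by rewrite /GRing.scale/= mulr1 -[LHS]mulr_natl mulfV.
exists (scale_atoms (NngNum m0) s0); rewrite !tot_scale /= t1.
have -> : tot shift s0 = 0.
  rewrite tot_shift t1 scale1r big_map big_enum/= -scaler_sumr.
  by rewrite -/empirical_mean subrr.
have tc (G : T * bool -> R^o) r : (forall x, G (x, false) = r) -> tot G s0 = r.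
  move=> Gr; rewrite -[RHS]mulr1 -t1 /tot mulr_sumr; apply: eq_big_seq => a.
  by case/mapP => i _ ->; rewrite Gr /mass /GRing.scale /= mulr1 mulrC.
rewrite (tc excess (- alpha)); last by move=> x; rewrite /excess/= sub0r.
rewrite (tc slack (alpha * M)); last by move=> x; rewrite /slack/= mul0r subr0.
rewrite scaler0 subr0 /GRing.scale/= mulr1 /m mulrDr mulrA mulfV ?gt_eqF// mul1r.
split.
- by rewrite lerDl mulr_ge0 ?(ltW eps0)// mulr_ge0// invr_ge0 ltW.
- rewrite mulrN lerNl mulrDl (mulrAC alpha^-1) mulVf ?gt_eqF// mul1r.
  rewrite (le_trans (ler_norm _))// normrN lerDr.
  by rewrite mulr_ge0 ?(ltW alpha0)// mulr_ge0// invr_ge0 ltW.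
- by rewrite mulrC.
Qed.

(** If a point of K were close to (0, 0, -1), cancelling its first two
    coordinates with [K_slater] would leave a negative last one, against
    [K_ge0]. *)
Let K_away : exists2 e, 0 < e & forall q, K q ->
  ~ [/\ `|q.1.1| <= e, `|q.1.2| <= e & `|q.2 + 1| <= e].
Proof.
have M0 : 0 <= M by apply: le_trans (FM (xi (Ordinal N0))).
have c0 : 0 <= value_lipschitz.
  by rewrite !mulr_ge0 ?addr_ge0 ?invr_ge0 ?(ltW alpha0) ?(ltW eps0).
exists (value_lipschitz + 2)^-1; first by rewrite invr_gt0; lra.
set e := (value_lipschitz + 2)^-1.
have e0 : 0 < e by rewrite invr_gt0; lra.
have ee : e * (value_lipschitz + 2) = 1 by rewrite mulVf//; lra.
move=> [[v b] r] /= Kq [hv hb hr].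
have := K_add Kq (K_slater (- v) (- b)).
have -> : (v, b, r) + (- v, - b, alpha * M * (eps^-1 * `|- v| + alpha^-1 * `|- b|))
   = (0, 0, r + alpha * M * (eps^-1 * `|- v| + alpha^-1 * `|- b|))
   :> (H * R^o * R^o)%type.
  by rewrite -[LHS]/(v - v, b - b, _) !subrr.
move=> /K_ge0; rewrite !normrN.
have : alpha * M * (eps^-1 * `|v| + alpha^-1 * `|b|) <= value_lipschitz * e.
  rewrite /value_lipschitz -[leRHS]mulrA ler_wpM2l ?mulr_ge0 ?(ltW alpha0)// mulrDl lerD//.
    by rewrite ler_wpM2l// invr_ge0 ltW.
  by rewrite ler_wpM2l// invr_ge0 ltW.
move: hr; rewrite ler_norml => /andP[_ hr]; lra.
Qed.

(** Strong duality: the normal vector at the projection of (0, 0, -1), scaled so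
    that its last coordinate is 1, is (g, M - t, 1). *)
Lemma cvar_certificate : exists (g : H) (g0 t : R),
  g0 + dot g empirical_mean + eps * `|g| <= t * alpha /\
  forall z, Num.max 0 (F z + t) <= g0 + rkhs_fun g z.
Proof.
pose B3 := fun p q : H * R^o * R^o =>
  dot p.1.1 q.1.1 + p.1.2 * q.1.2 + p.2 * q.2.
have BR : is_hilbert (fun a b : R^o => a * b).
  apply: is_hilbert_normed => [u v|a u v w|u].
  - exact: mulrC.
  - by rewrite mulrDl /GRing.scale/= mulrA.
  - by rewrite -normrX ger0_norm ?sqr_ge0// expr2.
have BH : is_hilbert B3 := is_hilbert_prod (is_hilbert_prod HH BR) BR.
pose x0 : H * R^o * R^o := (0, 0, -1).
have [|||p [Kp px pp]] := @cone_projection _ _ B3 BH K x0.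
- by eexists; exact: (K_slater 0 0).
- exact: K_add.
- by move=> a u; exact: K_scale.
pose nu := p - x0.
have nuK q : K q -> 0 <= B3 nu q.
  by move=> /px; rewrite -(opprB p x0) (hilbertNl BH) oppr_le0.
have nup : B3 nu p <= 0.
  by move: pp; rewrite -(opprB p x0) (hilbertNl BH) oppr_ge0.
have nunu : 0 < B3 nu nu.
  rewrite lt_neqAle (hilbert_ge0 BH) andbT eq_sym; apply/eqP => nu0.
  have [e e0 far] := K_away.
  have e20 : 0 < e ^+ 2 / 2 by rewrite divr_gt0 ?exprn_gt0.
  have [q Kq pq] := Kp _ e20; apply: (far q Kq).
  have : B3 (x0 - q) (x0 - q) <= e ^+ 2.
    apply: le_trans (hilbert_young BH (x0 - q) (x0 - p) ltr01) _.
    rewrite -{1 2}(opprB p x0) (hilbertNl BH) (hilbertNr BH) opprK nu0 mulr0 add0r.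
    have -> : x0 - q - (x0 - p) = p - q by rewrite opprB addrC addrA subrK.
    by rewrite invr1; lra.
  have -> : x0 - q = (- q.1.1, - q.1.2, - (q.2 + 1)).
    rewrite [in RHS]opprD [in RHS]addrC -[- q.1.1]sub0r -[- q.1.2]sub0r.
    by case: (q) => [[? ?] ?].
  rewrite /B3 /= (hilbertNl HH) (hilbertNr HH) opprK !mulrNN -rkhs_norm -!expr2.
  have sqrn (r : R) : r ^+ 2 = `|r| ^+ 2 by rewrite -normrX ger0_norm ?sqr_ge0.
  rewrite (sqrn q.1.2) (sqrn (q.2 + 1)) => sume.
  have sum3 (a b c r : R) : 0 <= a -> 0 <= b -> 0 <= c -> a + b + c <= r ->
    [/\ a <= r, b <= r & c <= r] by move=> *; split; lra.
  have [] := sum3 _ _ _ _ (sqr_ge0 _) (sqr_ge0 _) (sqr_ge0 _) sume.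
  by rewrite !ler_sqr ?nnegrE ?(ltW e0).
(* As K is a cone, the half-space of nu excludes x0 strictly. *)
have lam0 : 0 < nu.2.
  have : B3 nu x0 < 0.
    have -> : x0 = p - nu by rewrite /nu subKr.
    by rewrite (hilbertDr BH) (hilbertNr BH); lra.
  by rewrite /B3 /x0/= (hilbertC HH) (hilbert0l HH); lra.
pose g : H := nu.2^-1 *: nu.1.1; pose tau : R := nu.2^-1 * nu.1.2.
have gK (q : H * R^o * R^o) : K q -> 0 <= dot g q.1.1 + tau * q.1.2 + q.2.
  move=> /nuK; rewrite /B3 -(pmulr_rge0 _ (_ : 0 < nu.2^-1)) ?invr_gt0//.
  by rewrite !mulrDr !mulrA mulVf ?gt_eqF// mul1r (hilbertZl HH).
pose t := M - tau.
pose g0 := t * alpha - dot g empirical_mean - eps * `|g|.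
have key z (w : bool) : w%:R * (F z + t) <= g0 + rkhs_fun g z.
  (* The displacement of norm eps, allowed in K, that costs most against g;
     for g = 0 this is 0, since 0^-1 = 0. *)
  pose e : H := `|g|^-1 *: g.
  have e1 : `|e| <= 1.
    rewrite normrZ normfV normr_id; have [->|g0'] := eqVneq `|g| 0.
      by rewrite mulr0.
    by rewrite mulVf.
  have ge : dot g e = `|g|.
    rewrite (hilbertZr HH) -rkhs_norm expr2 mulrA.
    have [->|g0'] := eqVneq `|g| 0; first by rewrite mulr0.
    by rewrite mulVf// mul1r.
  have := gK (shift (z, w) - eps *: e, excess (z, w), slack (z, w)) _.
  rewrite /= (hilbertDr HH) (hilbertNr HH) (hilbertZr HH) ge.
  rewrite /shift /excess /slack /= (hilbertDr HH) (hilbertNr HH).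
  rewrite -rkhs_reproducing /g0 /t => h.
  suff : 0 <= rkhs_fun g z - dot g empirical_mean - eps * `|g| +
      tau * (w%:R - alpha) + (alpha * M - w%:R * (F z + M)) :> R by lra.
  apply: h; exists [:: (1%:nng, (z, w))].
  rewrite /tot !big_seq1 /= !scale1r; split=> //.
  by rewrite addrAC subrr add0r normrN normrZ gtr0_norm// /mass ler_pM2l.
exists g, g0, t; split; first by rewrite /g0; lra.
move=> z; have := key z true; have := key z false.
by rewrite mul0r mul1r ge_max => -> ->.
Qed.

End duality.

Theorem proposition2p3 (R : realType) (n m : nat)
    (X : set 'rV[R]_n) (Xi : set 'rV[R]_m) (Xi0 : Xi !=set0)
    (k : borel_subspace Xi0 -> borel_subspace Xi0 -> R)
    (k_posdef : sym_posdef_kernel k)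
    (k_meas : forall z : borel_subspace Xi0, measurable_fun setT (k z))
    (H : rkhs k)
    (f : 'rV[R]_n -> 'rV[R]_m -> R)
    (f_meas : forall x, X x ->
       measurable_fun setT (fun z : borel_subspace Xi0 => f x (subspace_val z)))
    (f_bounded : forall x, X x -> [bounded f x z | z in Xi])
    (alpha : R) (alpha_ge0 : 0 <= alpha)
    (eps : R) (eps_gt0 : 0 < eps)
    (N : nat) (N_gt0 : (0 < N)%N) (xi : 'I_N -> borel_subspace Xi0)
    (x : 'rV[R]_n) (Xx : X x) :
  (ereal_sup [set cvar P alpha (fun z => f x (subspace_val z))
             | P in mmd_ambiguity_set H (empirical R xi) eps] <= 0)%E
  <-> Z_cvar X H f alpha eps xi x.
Proof.
pose F (z : borel_subspace Xi0) := f x (subspace_val z).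
have mF : measurable_fun setT F := f_meas x Xx.
have [M FM] : exists M, forall z, `|F z| <= M.
  have [M [_ hM]] := f_bounded x Xx.
  exists (M + 1) => z; apply: (hM (M + 1)); first by rewrite ltrDl.
  exact: set_valP.
split=> [amb0|[_ [g [g0 [t [hg hF]]]]]]; last first.
  apply: ge_ereal_sup => _ [P Pamb <-].
  apply: (@cvar_le0_of_certificate _ _ _ k H k_meas N xi alpha eps F mF
    g g0 t) => //.
  by rewrite dot_empirical_mean.
split=> //.
have rkhs_fun0 z : rkhs_fun (0 : H) z = 0.
  by rewrite rkhs_reproducing (hilbert0l (is_hilbert_rkhs H)).
have trivial_certificate t : (forall z, Num.max 0 (F z + t) <= t * alpha) ->
    exists (g : H) (g0 t : R),
    g0 + N%:R^-1 * (\sum_(i < N) rkhs_fun g (xi i)) + eps * `|g| <= t * alpha /\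
    forall z : borel_subspace Xi0,
      Num.max 0 (f x (subspace_val z) + t) <= g0 + rkhs_fun g z.
  move=> ht; exists 0, (t * alpha), t; split.
    by rewrite big1 ?normr0 ?mulr0 ?addr0.
  by move=> z; rewrite rkhs_fun0 addr0; exact: ht.
have FleM z : F z <= M by apply: le_trans (ler_norm _) (FM z).
have [a1|a1] := ltP 1 alpha.
  have a1' : 0 < alpha - 1 by lra.
  have M0 : 0 <= M by apply: le_trans (FM point).
  have t0 : 0 <= M / (alpha - 1) by rewrite divr_ge0// ltW.
  apply: (trivial_certificate (M / (alpha - 1))) => z.
  rewrite ge_max mulr_ge0//=; have := FleM z.
  have : M / (alpha - 1) * (alpha - 1) = M by rewrite divfK// gt_eqF.
  by move: (M / (alpha - 1)) => t; lra.
move: alpha_ge0; rewrite le_eqVlt => /predU1P[a0|a0].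
  apply: (trivial_certificate (- M)) => z; rewrite -a0 mulr0 ge_max lexx/=.
  by have := FleM z; lra.
have [P Pamb|g [g0 [t [hg hF]]]] := @cvar_certificate _ _ _ k H k_meas N xi
  alpha eps F eps_gt0 N_gt0 mF M FM a0 a1.
  by apply: le_trans amb0; apply: ereal_sup_ubound; exists P.
exists g, g0, t; split=> //; move: hg.
by rewrite dot_empirical_mean.
Qed.
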